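(* Let $\mathfrak{q}=\mathfrak{l}\oplus\mathfrak{g}(1)\oplus\mathfrak{z}(\mathfrak{n})$ be a maximal parabolic subalgebra of quasi-Heisenberg type of one of the types $B_n(i)$ ($3\le i\le n$), $C_n(i)$ ($2\le i\le n-1$), $D_n(i)$ ($3\le i\le n-3$), $E_6(3)$, $E_6(5)$, $E_7(2)$, $E_7(6)$, $E_8(1)$, $F_4(4)$. If $V(\mu+\epsilon)$ is a special constituent of $\mathfrak{l}\otimes\mathfrak{z}(\mathfrak{n})$ of type 1a, then for any $\alpha\in\Delta_{\mu+\epsilon}(\mathfrak{g}(1))$ and any $\gamma_j\in\Delta_{\mu+\epsilon}(\mathfrak{z}(\mathfrak{n}))$ we have $\gamma_j-\alpha\in\Delta$.
   Context: $\mathfrak{g}$ is a complex simple Lie algebra with Borel subalgebra $\mathfrak{b}\supset\mathfrak{h}$ (Cartan), roots $\Delta$, simple roots $\Pi$. ''$\mathfrak{q}$ is of type $\mathcal{T}(i)$'' means $\mathfrak{g}$ has type $\mathcal{T}$ and $\mathfrak{q}=\mathfrak{l}\oplus\mathfrak{n}$ is the standard maximal parabolic determined by $\alpha_\mathfrak{q}=\alpha_i$ (Bourbaki numbering): $\mathfrak{l}=\mathfrak{h}$ plus root spaces for roots in $\mathrm{span}(\Pi\setminus\{\alpha_\mathfrak{q}\})$, $\mathfrak{n}$ the remaining positive root spaces. Quasi-Heisenberg type: $[\mathfrak{n},[\mathfrak{n},\mathfrak{n}]]=0$, $\dim[\mathfrak{n},\mathfrak{n}]>1$. $\mathfrak{n}=\mathfrak{g}(1)\oplus\mathfrak{z}(\mathfrak{n})$,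 where $\mathfrak{g}(1)$ (resp. the center $\mathfrak{z}(\mathfrak{n})$) is the sum of the root spaces of roots with $\alpha_\mathfrak{q}$-coefficient $1$ (resp. $2$). $L$ is the Levi subgroup with Lie algebra $\mathfrak{l}$, acting by $\mathrm{Ad}$. $\Delta(W)$ denotes the roots whose root spaces lie in $W$, and $\Delta_\nu(W)=\{\alpha\in\Delta(W):\nu-\alpha\in\Delta\}$. $\mu$ is the highest weight of the irreducible $L$-module $\mathfrak{g}(1)$ and $\gamma$ (the highest root) that of $\mathfrak{z}(\mathfrak{n})$. An irreducible $L$-constituent $V(\nu)$ (highest weight $\nu$) of $\mathfrak{l}\otimes\mathfrak{z}(\mathfrak{n})$ is special if $\nu\neq\gamma$ and $\nu=\mu+\epsilon$ for some $\epsilon\in\Delta(\mathfrak{g}(1))$; it is of type 1a if $\mu+\epsilon\notin\Delta$, $\epsilon\neq\mu$, and both $\mu$ and $\epsilon$ are long roots (all roots are regarded as long if $\mathfrak{g}$ is simply laced). *)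

(* Defs.v *)
From HB Require Import structures.
From mathcomp Require Import all_boot all_order all_algebra.
From mathcomp Require Import boolp classical_sets reals.
From mathcomp Require Import topology normedtype sequences.
From mathcomp Require Export complex.

Set Implicit Arguments.
Unset Strict Implicit.
Unset Printing Implicit Defensive.

Import Order.TTheory GRing.Theory Num.Theory.
Import numFieldNormedType.Exports.
Local Open Scope classical_set_scope.
Local Open Scope ring_scope.

Section LinearSpan.
Variables (K : fieldType) (V : vectType K).

Definition least_subspace (S : set V) : set {vspace V} :=
  [set U : {vspace V} | S `<=` [set` U] /\ forall W : {vspace V}, S `<=` [set` W] -> (U <= W)%VS].

Definition lspan (S : set V) : {vspace V} := xget 0%VS (least_subspace S).

(* [lspan] never takes its default value. *)
Lemma lspanP (S : set V) : least_subspace S (lspan S).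
Proof.
apply: xgetPex.
suff H n (U : {vspace V}) : (\dim {:V} - \dim U <= n)%N ->
    (forall W : {vspace V}, S `<=` [set` W] -> (U <= W)%VS) -> exists W, least_subspace S W.
  by apply: (H _ 0%VS (leqnn _)) => W _; exact: sub0v.
elim: n U => [|n IH] U hn hU.
  exists U; split=> // x _ /=; have -> : U = fullv; last exact: memvf.
  apply/eqP; rewrite eqEdim subvf /=.
  by rewrite -subn_eq0; move: hn; rewrite leqn0.
case: (pselect (S `<=` [set` U])) => [SU|nSU]; first by exists U.
have [x Sx xU] : exists2 x, S x & x \notin U.
  apply: contrapT => H; apply: nSU => x Sx /=.
  by apply: contrapT => /negP xU; apply: H; exists x.
apply: (IH (U + <[x]>)%VS); last first.
  by move=> W SW; rewrite subv_add hU //=; exact: SW.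
rewrite -ltnS; apply: leq_trans hn.
rewrite ltn_sub2l //.
  rewrite ltnNge; apply: contra xU => h.
  have /eqP -> : U == fullv by rewrite eqEdim subvf.
  exact: memvf.
rewrite ltnNge; apply: contra xU => h.
have : (U + <[x]> <= U)%VS.
  have /eqP <- // : U == (U + <[x]>)%VS by rewrite eqEdim addvSl.
by rewrite subv_add => /andP[_].
Qed.

(* The trace does not depend on the basis in which it is computed. *)
Definition lfun_trace (f : 'End(V)) : K :=
  \sum_(i < \dim {:V}) coord (vbasis {:V}) i (f (tnth (vbasis {:V}) i)).

End LinearSpan.

Lemma linfunE_of (K : fieldType) (U V : vectType K) (f : U -> V) :
  linear f -> linfun f =1 f.
Proof.
move=> linf x.
pose F : {linear U -> V} := HB.pack f (GRing.isLinear.Build K U V _ f linf).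
by rewrite -[f]/(F : U -> V) lfunE.
Qed.

Record lieAlgebra (K : fieldType) := LieAlgebra {
  lie_sort :> vectType K;
  bracket : lie_sort -> lie_sort -> lie_sort;
  bracket_linearl : forall y, linear (bracket^~ y);
  bracket_linearr : forall x, linear (bracket x);
  bracketxx : forall x, bracket x x = 0;
  jacobi : forall x y z,
    bracket x (bracket y z) + bracket y (bracket z x) + bracket z (bracket x y)
      = 0 }.

Section LieAlgebra.
Variables (K : fieldType) (g : lieAlgebra K).

Definition ad (x : g) : 'End(g) := linfun (bracket x).

Lemma adE x y : ad x y = bracket x y.
Proof. exact: (linfunE_of (bracket_linearr x)). Qed.

Definition bracketv (U V : {vspace g}) : {vspace g} :=
  lspan [set z | exists x y, [/\ x \in U, y \in V & z = bracket x y]].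

Definition ideal (I : {vspace g}) := forall x y : g, y \in I -> bracket x y \in I.

Definition simple_lie :=
  (exists x y : g, bracket x y <> 0) /\
  forall I : {vspace g}, ideal I -> I = 0%VS \/ I = fullv.

Definition killing (x y : g) : K := lfun_trace (ad x \o ad y)%VF.

Definition abelian_sub (h : {vspace g}) :=
  {in h &, forall x y : g, bracket x y = 0}.

Definition diagonalizable_end (f : 'End(g)) :=
  exists2 b : seq g, basis_of fullv b &
    forall v, v \in b -> exists c, f v = c *: v.

(* Cartan subalgebra of a semisimple Lie algebra over an algebraically closed
   field: maximal abelian, consisting of ad-semisimple elements. *)
Definition cartan_subalgebra (h : {vspace g}) :=
  [/\ abelian_sub h,
      forall a : {vspace g}, abelian_sub a -> (h <= a)%VS -> a = h
    & {in h, forall x, diagonalizable_end (ad x)}].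

End LieAlgebra.

Local Notation dual h := 'Hom(subvs_of h, (_)^o).

Section Roots.
Variables (K : numClosedFieldType) (g : lieAlgebra K) (h : {vspace g}).
Implicit Types (alpha beta lambda nu : dual h) (W : {vspace g}).

Definition root_space alpha : set g :=
  [set x | forall H : subvs_of h, bracket (vsval H) x = alpha H *: x].

Definition is_root : set (dual h) :=
  [set alpha | alpha <> 0 /\ exists2 x, root_space alpha x & x <> 0].

Definition sum_root_spaces (A : set (dual h)) : {vspace g} :=
  lspan (\bigcup_(alpha in A `&` is_root) root_space alpha).

Definition roots_in W : set (dual h) :=
  [set alpha | is_root alpha /\ root_space alpha `<=` [set` W]].

Definition roots_in_for nu W : set (dual h) :=
  [set alpha | roots_in W alpha /\ is_root (nu - alpha)].

(* The vector of [h] representing [lambda] through the Killing form, and the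
   form so induced on the dual of [h]. *)
Definition killing_vec lambda : subvs_of h :=
  xget 0 [set t : subvs_of h |
    forall H : subvs_of h, killing (vsval t) (vsval H) = lambda H].

Definition dual_form lambda nu : K :=
  killing (vsval (killing_vec lambda)) (vsval (killing_vec nu)).

Definition long alpha :=
  forall beta, is_root beta -> dual_form beta beta <= dual_form alpha alpha.

Section SimpleRoots.
Variables (n : nat) (Pi : n.-tuple (dual h)).

Definition simple_roots :=
  [/\ basis_of fullv Pi, forall j, is_root (tnth Pi j)
    & forall alpha, is_root alpha ->
        (forall j, exists k : nat, coord Pi j alpha = k%:R) \/
        (forall j, exists k : nat, coord Pi j alpha = - k%:R)].

Definition positive_root : set (dual h) :=
  [set alpha | is_root alpha /\ forall j, 0 <= coord Pi j alpha].

Variable i : 'I_n.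

Let levi_roots : set (dual h) :=
  [set alpha | alpha \in <<[seq tnth Pi j | j <- enum 'I_n & j != i]>>%VS].

Definition levi : {vspace g} := (h + sum_root_spaces levi_roots)%VS.

Definition nilradical : {vspace g} :=
  sum_root_spaces (positive_root `\` levi_roots).

Definition grade1 : {vspace g} :=
  sum_root_spaces [set alpha | coord Pi i alpha = 1].

(* When the nilradical is quasi-Heisenberg, this is its center. *)
Definition center_nil : {vspace g} :=
  sum_root_spaces [set alpha | coord Pi i alpha = 2%:R].

Definition quasi_heisenberg :=
  bracketv nilradical (bracketv nilradical nilradical) = 0%VS /\
  (1 < \dim (bracketv nilradical nilradical))%N.

End SimpleRoots.
End Roots.

Section LeviModules.
Variables (K : numClosedFieldType) (g : lieAlgebra K).

Definition is_exp (f e : 'End(g)) :=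
  forall (phi : 'Hom(g, K^o)) (v : g),
    (fun m : nat => \sum_(k < m) (k`!%:R)^-1 * phi (iter k f v) : K^o) @ \oo
      --> (phi (e v) : K^o).

(* [Ad_of l] is Ad(L) for the connected group L with Lie algebra [l]: such an
   L is generated by the exp x, and Ad (exp x) = exp (ad x). *)
Inductive Ad_of (l : {vspace g}) : set 'End(g) :=
| Ad_exp x e : x \in l -> is_exp (ad x) e -> Ad_of l e
| Ad_one : Ad_of l \1%VF
| Ad_mul e1 e2 : Ad_of l e1 -> Ad_of l e2 -> Ad_of l (e1 \o e2)%VF.

(* The tensor square of g, as the space of linear maps from g^* to g: the pure
   tensor u (x) v is the map phi |-> phi(u) v. *)
Definition tensor2 := 'Hom('Hom(g, K^o), g).

Definition tens (u v : g) : tensor2 :=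
  linfun (fun phi : 'Hom(g, K^o) => (phi u : K) *: v).

Definition tensorv (U V : {vspace g}) : {vspace tensor2} :=
  lspan [set t | exists u v, [/\ u \in U, v \in V & t = tens u v]].

Definition tens_map (a b : 'End(g)) : 'End(tensor2) :=
  linfun (fun t : tensor2 =>
    (b \o t \o linfun (fun phi : 'Hom(g, K^o) => phi \o a))%VF).

Lemma tensE u v phi : tens u v phi = (phi u : K) *: v.
Proof.
have lin : linear (fun phi : 'Hom(g, K^o) => (phi u : K) *: v).
  by move=> c p q; rewrite !lfunE /= !lfunE /= scalerDl scalerA.
exact: (linfunE_of lin).
Qed.

Lemma tens_mapE a b u v : tens_map a b (tens u v) = tens (a u) (b v).
Proof.
have lin1 : linear (fun phi : 'Hom(g, K^o) => (phi \o a)%VF).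
  move=> c p q; apply/lfunP => x.
  by rewrite !(comp_lfunE, add_lfunE, scale_lfunE).
have lin2 : linear (fun t : tensor2 =>
    (b \o t \o linfun (fun phi : 'Hom(g, K^o) => phi \o a))%VF).
  move=> c p q; apply/lfunP => x.
  by rewrite !(comp_lfunE, add_lfunE, scale_lfunE) linearP.
apply/lfunP => phi.
rewrite (linfunE_of lin2) !comp_lfunE (linfunE_of lin1) !tensE comp_lfunE.
by rewrite linearZ.
Qed.

Definition tens_ad (x : g) : 'End(tensor2) :=
  tens_map (ad x) \1%VF + tens_map \1%VF (ad x).

Definition tens_Ad (l : {vspace g}) : set 'End(tensor2) :=
  [set tens_map e e | e in Ad_of l].

Definition submodule (V : vectType K) (G : set 'End(V)) (U : {vspace V}) :=
  forall e, G e -> (e @: U <= U)%VS.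

Definition irreducible_module (V : vectType K) (G : set 'End(V))
    (U : {vspace V}) :=
  [/\ U <> 0%VS, submodule G U & forall W : {vspace V},
      (W <= U)%VS -> submodule G W -> W = 0%VS \/ W = U].

Section HighestWeight.
Variables (h : {vspace g}) (n : nat) (Pi : n.-tuple (dual h)) (i : 'I_n).
Implicit Types (mu gamma nu epsilon : dual h).

Notation l := (levi Pi i).

Definition highest_weight (V : vectType K) (rho : g -> 'End(V))
    (U : {vspace V}) nu :=
  exists v : V, [/\ v \in U, v <> 0,
    forall H : subvs_of h, rho (vsval H) v = nu H *: v
  & forall alpha x, positive_root Pi alpha -> roots_in l alpha ->
      root_space alpha x -> rho x v = 0].

Definition constituent nu :=
  exists U : {vspace tensor2},
    [/\ (U <= tensorv l (center_nil Pi i))%VS,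
        irreducible_module (tens_Ad l) U & highest_weight tens_ad U nu].

Definition special mu gamma nu :=
  [/\ constituent nu, nu <> gamma
    & exists2 epsilon, roots_in (grade1 Pi i) epsilon & nu = mu + epsilon].

Definition type_1a mu epsilon :=
  [/\ ~ is_root (mu + epsilon), epsilon <> mu, long mu & long epsilon].

End HighestWeight.
End LeviModules.

Local Close Scope ring_scope.

Inductive dynkin_type :=
  | TypeA of nat | TypeB of nat | TypeC of nat | TypeD of nat
  | TypeE6 | TypeE7 | TypeE8 | TypeF4 | TypeG2.

Definition lie_rank (T : dynkin_type) : nat :=
  match T with
  | TypeA n | TypeB n | TypeC n | TypeD n => n
  | TypeE6 => 6 | TypeE7 => 7 | TypeE8 => 8 | TypeF4 => 4 | TypeG2 => 2
  end.

(* In Bourbaki's numbering (from 1), the adjacency relation of the Dynkin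
   diagram, each edge being listed with its smaller end first. *)
Definition dynkin_edge (T : dynkin_type) (i j : nat) : bool :=
  match T with
  | TypeD n => ((j == i.+1) && (j < n)) || ((j == i.+2) && (j == n))
  | TypeE6 | TypeE7 | TypeE8 =>
      (i, j) \in [:: (1, 3); (2, 4); (3, 4); (4, 5); (5, 6); (6, 7); (7, 8)]
  | _ => j == i.+1
  end.

(* The pairs (i, j) of adjacent nodes with <alpha_i, alpha_j^vee> <> -1, with
   the absolute value of that integer; alpha_i is then the longer root. *)
Definition dynkin_mult (T : dynkin_type) (i j : nat) : nat :=
  match T with
  | TypeB n => if (i.+1 == n) && (j == n) then 2 else 1
  | TypeC n => if (i == n) && (j.+1 == n) then 2 else 1
  | TypeF4 => if (i == 2) && (j == 3) then 2 else 1
  | TypeG2 => if (i == 2) && (j == 1) then 3 else 1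
  | _ => 1
  end.

Local Open Scope ring_scope.

Definition bourbaki_cartan (T : dynkin_type) (i j : nat) : int :=
  if i == j then 2
  else if dynkin_edge T i j || dynkin_edge T j i then - (dynkin_mult T i j)%:Z
  else 0.

Definition cartan_integer (K : numClosedFieldType) (g : lieAlgebra K)
    (h : {vspace g}) (alpha beta : dual h) : K :=
  2%:R * dual_form alpha beta / dual_form beta beta.

Definition has_type (K : numClosedFieldType) (g : lieAlgebra K)
    (h : {vspace g}) (T : dynkin_type) (Pi : (lie_rank T).-tuple (dual h)) :=
  forall i j : 'I_(lie_rank T),
    cartan_integer (tnth Pi i) (tnth Pi j)
      = (bourbaki_cartan T i.+1 j.+1)%:~R.

Arguments has_type {K g h} T Pi.

Definition listed_type (T : dynkin_type) (i : nat) : bool :=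
  match T with
  | TypeB n => (3 <= i <= n)%N
  | TypeC n => (2 <= i <= n - 1)%N
  | TypeD n => (3 <= i <= n - 3)%N
  | TypeE6 => i \in [:: 3; 5]%N
  | TypeE7 => i \in [:: 2; 6]%N
  | TypeE8 => i == 1%N
  | TypeF4 => i == 4%N
  | _ => false
  end.

(* Main.v *)
Require Import Defs.
From mathcomp Require Import all_boot all_order all_algebra.
From mathcomp Require Import boolp classical_sets reals complex.
From mathcomp Require Import ring zify.

Set Implicit Arguments.
Unset Strict Implicit.
Unset Printing Implicit Defensive.

Import Order.TTheory GRing.Theory Num.Theory.

Local Open Scope ring_scope.
Local Open Scope complex_scope.

(** The hypothesis [has_type] forces the Killing form to be nonzero, so by
    simplicity it is nondegenerate, and the classical root theory follows: root
    strings give integral pairings, and the form is positive definite on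
    differences of roots.  Normalize long roots to length [N].  A root other
    than the long root [mu] pairs with it to at most [N / 2].  Write
    [mu + epsilon] as [gamma_j + beta] with [beta] a root of degree 0; pairing
    with [mu] and [epsilon] forces [mu] and [epsilon] to be orthogonal and
    [gamma_j], [beta] to pair to exactly [N / 2] with both.  Integrality then
    leaves only the case that [gamma_j] is long.  Pairing
    [mu + epsilon = alpha + alpha'] with [gamma_j] yields [N], while each
    summand contributes at most [N / 2]; so [alpha] and [gamma_j] pair
    positively and their difference is a root. *)

(** * Traces in arbitrary bases, and spanning families *)

Section Trace.
Variables (K : fieldType) (V : vectType K).
Implicit Types (f e : 'End(V)) (v : V).

(** Expanding [e X_i] in [Y] and [f Y_j] in [X] turns both sides into the same double sum. Taking
    one map to be the identity gives basis independence of the trace; taking [X = Y] gives its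
    cyclicity. *)
Lemma trace_comp_swap m n (X : m.-tuple V) (Y : n.-tuple V) f e :
    basis_of fullv X -> basis_of fullv Y ->
  \sum_(i < m) coord X i (f (e X`_i)) = \sum_(j < n) coord Y j (e (f Y`_j)).
Proof.
move=> bX bY.
transitivity (\sum_(i < m) \sum_(j < n) coord Y j (e X`_i) * coord X i (f Y`_j)).
  apply: eq_bigr => i _; rewrite {1}(coord_basis bY (memvf (e X`_i))).
  by rewrite !linear_sum /=; apply: eq_bigr => j _; rewrite !linearZ.
rewrite exchange_big; apply: eq_bigr => j _ /=.
rewrite {2}(coord_basis bX (memvf (f Y`_j))) !linear_sum /=.
by apply: eq_bigr => i _; rewrite !linearZ mulrC.
Qed.

Lemma lfun_traceE n (X : n.-tuple V) f :
  basis_of fullv X -> lfun_trace f = \sum_i coord X i (f X`_i).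
Proof.
move=> bX; rewrite /lfun_trace.
under eq_bigr do rewrite (tnth_nth 0).
transitivity (\sum_(i < n) coord X i (\1%VF (f X`_i))).
  rewrite -(trace_comp_swap f \1%VF (vbasisP fullv) bX).
  by apply: eq_bigr => i _; rewrite id_lfunE.
by apply: eq_bigr => i _; rewrite id_lfunE.
Qed.

Lemma lfun_traceC f e : lfun_trace (f \o e)%VF = lfun_trace (e \o f)%VF.
Proof.
rewrite !(lfun_traceE _ (vbasisP fullv)).
under eq_bigr do rewrite comp_lfunE.
under [RHS]eq_bigr do rewrite comp_lfunE.
exact: trace_comp_swap (vbasisP _) (vbasisP _).
Qed.

Lemma lfun_trace_linear : linear (@lfun_trace K V : 'End(V) -> K^o).
Proof.
move=> c f e; rewrite /lfun_trace scaler_sumr -big_split /=.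
by apply: eq_bigr => i _; rewrite add_lfunE scale_lfunE linearP.
Qed.

Lemma lfun_trace0 : lfun_trace (0 : 'End(V)) = 0.
Proof. by rewrite /lfun_trace big1 // => i _; rewrite lfunE /= linear0. Qed.

Lemma basis_of_spanning (s : seq V) : <<s>>%VS = fullv ->
  exists2 b : seq V, basis_of fullv b & {subset b <= s}.
Proof.
suff [b fb [eb sb]] : exists2 b : seq V, free b &
    (<<b>> = <<s>>)%VS /\ {subset b <= s}.
  by move=> es; exists b => //; rewrite basisEfree fb eb es subvv /=
    -(eqnP fb) eb es leqnn.
elim: s => [|x s [b fb [eb sb]]]; first by exists [::]; rewrite ?nil_free.
have [xb|xb] := boolP (x \in <<b>>%VS).
  exists b => //; split; last by move=> y /sb; rewrite inE orbC => ->.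
  by rewrite span_cons -eb; apply/esym/addv_idPr.
exists (x :: b); first by rewrite free_cons xb.
split; first by rewrite !span_cons eb.
by move=> y; rewrite !inE => /predU1P[->|/sb ->]; rewrite ?eqxx ?orbT.
Qed.

Lemma eq_lfun_spanning (W : vectType K) (s : seq V) (f e : 'Hom(V, W)) :
  <<s>>%VS = fullv -> {in s, f =1 e} -> f = e.
Proof.
move=> es fe; apply/lfunP => v; apply/eqlfunP.
have: (<<s>> <= lker (f - e))%VS by apply/span_subvP => u /fe ?; apply/eqlfunP.
by rewrite es => /subvP; apply; exact: memvf.
Qed.

End Trace.

(** * Spectral projections of a diagonalizable endomorphism *)

Section SpectralProjections.
Variables (K : fieldType) (V : vectType K) (f : 'End(V)).

(** The Lagrange interpolation polynomial of [c] with nodes [s], evaluated at [f]. Being a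
    polynomial in [f], it commutes with whatever commutes with [f]. *)
Definition spectral_proj (s : seq K) (c : K) : 'End(V) :=
  foldr (fun d F => if d == c then F
                    else (((c - d)^-1 *: (f - d *: \1)) \o F)%VF) \1%VF s.

Lemma spectral_proj_eigen s a c v : f v = a *: v ->
  spectral_proj s c v = (\prod_(d <- s | d != c) ((a - d) / (c - d))) *: v.
Proof.
move=> fv; elim: s => [|d s IH] /=; first by rewrite big_nil id_lfunE scale1r.
rewrite big_cons; case: eqP => //= _.
rewrite comp_lfunE IH scale_lfunE add_lfunE opp_lfunE scale_lfunE id_lfunE.
rewrite linearZ /= fv !scalerA -scalerBl !scalerA; congr (_ *: _).
by ring.
Qed.

Lemma spectral_proj_comm s c (e : 'End(V)) :
    (forall v, e (f v) = f (e v)) ->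
  forall v, e (spectral_proj s c v) = spectral_proj s c (e v).
Proof.
move=> ef; elim: s => [|d s IH] v /=; first by rewrite !id_lfunE.
case: eqP => // _.
rewrite !(comp_lfunE, scale_lfunE, add_lfunE, opp_lfunE, id_lfunE).
by rewrite linearZ linearB linearZ /= ef IH.
Qed.

(** On an eigenvector for [a], the interpolation product is 1 if [a = c] and otherwise contains the
    zero factor [d = a]. Both identities can thus be checked on the eigenbasis. *)
Lemma spectral_decomposition (b : seq V) : basis_of fullv b ->
    (forall v, v \in b -> exists c, f v = c *: v) ->
  exists s : seq K, forall v, v = \sum_(c <- s) spectral_proj s c v /\
    forall c, f (spectral_proj s c v) = c *: spectral_proj s c v.
Proof.
move=> /span_basis bb fb.
have [s sP] : exists s : seq K, forall v, v \in b ->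
    exists2 c, c \in s & f v = c *: v.
  elim: b {bb} fb => [|x b IH] fb; first by exists [::].
  have [c fx] := fb x (mem_head _ _).
  have [|s sP] := IH; first by move=> v vb; apply: fb; rewrite inE vb orbT.
  exists (c :: s) => v; rewrite inE => /predU1P[->|/sP[d ds fv]].
    by exists c; rewrite ?mem_head.
  by exists d; rewrite // inE ds orbT.
have projb v c : v \in b ->
    spectral_proj (undup s) c v = (f v == c *: v)%:R *: v.
  move=> /sP[a as_ fv]; rewrite (spectral_proj_eigen _ _ fv) fv.
  have [->|ac] := eqVneq a c.
    rewrite eqxx big1 // => d dc; rewrite divff // subr_eq0.
    by rewrite eq_sym.
  rewrite (big_rem a) ?mem_undup //= ac subrr !mul0r scale0r.
  rewrite -subr_eq0 -scalerBl scaler_eq0 subr_eq0 (negPf ac) /=.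
  by case: eqP => [->|]; rewrite ?scaler0 ?scale0r.
(* Duplicates are removed because a repeated eigenvalue would count its projection twice in the
   sum. *)
exists (undup s) => v; split.
  have : \1%VF = \sum_(c <- undup s) spectral_proj (undup s) c.
    apply: (eq_lfun_spanning bb) => u ub; rewrite id_lfunE sum_lfunE.
    have [->|u0] := eqVneq u 0.
      by rewrite big1 // => c _; rewrite linear0.
    have [a as_ fu] := sP u ub.
    rewrite (bigD1_seq a) ?undup_uniq ?mem_undup //= projb // fu eqxx scale1r.
    rewrite big1 ?addr0 // => c ca; rewrite projb // fu.
    rewrite -subr_eq0 -scalerBl scaler_eq0 (negPf u0) orbF subr_eq0 eq_sym.
    by rewrite (negPf ca) scale0r.
  by move/lfunP/(_ v); rewrite id_lfunE sum_lfunE.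
move=> c; set F := spectral_proj _ c.
have : (f \o F = c *: F)%VF.
  apply: (eq_lfun_spanning bb) => u ub; rewrite comp_lfunE scale_lfunE projb //.
  rewrite linearZ /=.
  by case: eqP => [->|_]; rewrite ?scale1r // !scale0r scaler0.
by move/lfunP/(_ v); rewrite comp_lfunE scale_lfunE.
Qed.

(** If [c] is not in [s], each spectral component of [v] is scaled by [f] both by [c] and by some
    [d] other than [c], so it vanishes, and [v] with it. *)
Lemma eigenvalues_finite (b : seq V) : basis_of fullv b ->
    (forall v, v \in b -> exists c, f v = c *: v) ->
  exists s : seq K, forall v c, v <> 0 -> f v = c *: v -> c \in s.
Proof.
move=> bb fb; have [s sP] := spectral_decomposition bb fb.
exists s => v c v0 fv; apply/negPn/negP => cs; apply: v0.
rewrite (sP v).1 big_seq big1 // => d ds.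
have := (sP v).2 d; rewrite (spectral_proj_comm _ _ (fun _ => erefl)) fv linearZ.
move/eqP; rewrite -subr_eq0 -scalerBl scaler_eq0 subr_eq0 => /orP[/eqP cd|/eqP //].
by rewrite cd ds in cs.
Qed.

End SpectralProjections.

(** * Bracket identities and the Killing form *)

Section Bracket.
Variables (K : fieldType) (g : lieAlgebra K).
Implicit Types x y z : g.

Lemma bracketDl x y z : bracket (x + y) z = bracket x z + bracket y z.
Proof. by have := bracket_linearl z 1 x y; rewrite !scale1r. Qed.

Lemma bracketDr x y z : bracket x (y + z) = bracket x y + bracket x z.
Proof. by have := bracket_linearr x 1 y z; rewrite !scale1r. Qed.

Lemma bracketC x y : bracket x y = - bracket y x.
Proof.
apply/eqP; rewrite -addr_eq0; apply/eqP.
have := bracketxx (x + y).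
by rewrite bracketDl !bracketDr !bracketxx add0r addr0.
Qed.

Lemma bracket0l x : bracket 0 x = 0.
Proof. by rewrite bracketC -adE linear0 oppr0. Qed.

Lemma bracketZl c x y : bracket (c *: x) y = c *: bracket x y.
Proof. by rewrite !(bracketC _ y) -!adE linearZ scalerN. Qed.

Lemma bracketZr c x y : bracket x (c *: y) = c *: bracket x y.
Proof. by rewrite -!adE linearZ. Qed.

Lemma ad_linear : linear (@ad _ g).
Proof.
move=> c x y; apply/lfunP => z.
by rewrite add_lfunE scale_lfunE !adE bracket_linearl.
Qed.

Lemma jacobi_ad x y z :
  bracket (bracket x y) z = bracket x (bracket y z) - bracket y (bracket x z).
Proof.
have /eqP := jacobi x y z; rewrite addr_eq0 => /eqP.
rewrite [in RHS]bracketC opprK => <-; congr (_ + _).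
by rewrite (bracketC z x) -!adE linearN.
Qed.

Lemma adB x y : ad (bracket x y) = ((ad x \o ad y) - (ad y \o ad x))%VF.
Proof.
apply/lfunP => z.
by rewrite add_lfunE opp_lfunE !comp_lfunE !adE jacobi_ad.
Qed.

Lemma killingC x y : killing x y = killing y x.
Proof. exact: lfun_traceC. Qed.

Lemma killing_linearl y : linear (fun x => killing x y : K^o).
Proof.
move=> c x z; rewrite /killing ad_linear.
have -> : ((c *: ad x + ad z) \o ad y)%VF
    = c *: (ad x \o ad y)%VF + (ad z \o ad y)%VF.
  by apply/lfunP => v; rewrite !(comp_lfunE, add_lfunE, scale_lfunE).
exact: lfun_trace_linear.
Qed.

Lemma killing_linearr x : linear (fun y => killing x y : K^o).
Proof. by move=> c y z; rewrite !(killingC x) killing_linearl. Qed.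

Definition killing_form (x : g) : 'Hom(g, K^o) := linfun (fun y => killing x y : K^o).

Lemma killing_formE x y : killing_form x y = killing x y.
Proof. exact: (linfunE_of (killing_linearr x)). Qed.

Lemma killingZl c x y : killing (c *: x) y = c * killing x y.
Proof. by rewrite !(killingC _ y) -!killing_formE linearZ. Qed.

Lemma killingNl x y : killing (- x) y = - killing x y.
Proof. by rewrite !(killingC _ y) -!killing_formE linearN. Qed.

Lemma killingBl x y z : killing (x - y) z = killing x z - killing y z.
Proof. by rewrite !(killingC _ z) -!killing_formE linearB. Qed.

(** After expanding the commutators, the two sides differ only by [tr(y (x z))] against
    [tr((x z) y)], equal by cyclicity. *)
Lemma killing_invariant x y z : killing (bracket x y) z = killing x (bracket y z).
Proof.
rewrite /killing !adB.
have -> : (((ad x \o ad y) - (ad y \o ad x)) \o ad z)%VF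
    = (-1) *: (ad y \o (ad x \o ad z))%VF + (ad x \o (ad y \o ad z))%VF.
  apply/lfunP => v; rewrite !(comp_lfunE, add_lfunE, scale_lfunE, opp_lfunE).
  by rewrite scaleN1r addrC.
have -> : (ad x \o ((ad y \o ad z) - (ad z \o ad y)))%VF
    = (-1) *: ((ad x \o ad z) \o ad y)%VF + (ad x \o (ad y \o ad z))%VF.
  apply/lfunP => v; rewrite !(comp_lfunE, add_lfunE, scale_lfunE, opp_lfunE).
  by rewrite linearB scaleN1r addrC.
by rewrite !lfun_trace_linear (lfun_traceC (ad y)).
Qed.

(** By invariance the radical of the form is an ideal, so it is 0 or everything; a single nonzero
    value excludes the latter. *)
Lemma killing_nondegenerate : simple_lie g ->
    (exists x y : g, killing x y <> 0) ->
  forall x : g, (forall y, killing x y = 0) -> x = 0.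
Proof.
move=> [_ simp] [x0 [y0 k0]] x kx.
have lin : linear killing_form.
  move=> c u v; apply/lfunP => y.
  by rewrite add_lfunE scale_lfunE !killing_formE killing_linearl.
have radP u : reflect (forall y, killing u y = 0) (u \in lker (linfun killing_form)).
  rewrite memv_ker (linfunE_of lin); apply: (iffP eqP) => [/lfunP ku y|ku].
    by rewrite -killing_formE ku lfunE.
  by apply/lfunP => y; rewrite killing_formE ku lfunE.
have radI : ideal (lker (linfun killing_form)).
  move=> u v /radP kv; apply/radP => y.
  by rewrite bracketC killingNl killing_invariant kv oppr0.
case: (simp _ radI) => rad; last by case: k0; apply/radP; rewrite rad memvf.
by have /radP := kx; rewrite rad memv0 => /eqP.
Qed.

End Bracket.

(** * Weight decomposition under the Cartan subalgebra *)

Section CartanDecomposition.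
Variables (K : numClosedFieldType) (g : lieAlgebra K) (h : {vspace g}).
Local Notation dual := 'Hom(subvs_of h, K^o).
Implicit Types (alpha beta lambda mu epsilon rho sigma : dual) (x y e f v : g) (H : subvs_of h).

Hypothesis h_cartan : cartan_subalgebra h.

(** Induction on [s]: the family for the tail is split by the spectral projections of [ad x]. These
    commute with every [ad y], as [h] is abelian, so the pieces remain eigenvectors for the tail.
    Some pieces may vanish, hence a spanning family and not a basis. *)
Lemma joint_eigenspanning (s : seq g) : {subset s <= h} ->
  exists2 b : seq g, <<b>>%VS = fullv &
    forall v x, v \in b -> x \in s -> exists c, bracket x v = c *: v.
Proof.
have [abh _ diagh] := h_cartan.
elim: s => [|x s IH] sh.
  by exists (vbasis fullv); rewrite ?(span_basis (vbasisP _)).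
have xh : x \in h by apply: sh; rewrite mem_head.
have [|b bb eb] := IH; first by move=> y ys; apply: sh; rewrite inE ys orbT.
have [bx bxb ebx] := diagh x xh.
have [sc scP] := spectral_decomposition bxb ebx.
exists [seq spectral_proj (ad x) sc c v | v <- b, c <- sc].
  apply/eqP; rewrite eqEsubv subvf /= -bb; apply/span_subvP => v vb.
  rewrite (scP v).1 big_seq; apply: memv_suml => c csc.
  by apply: memv_span; apply/allpairsP; exists (v, c).
move=> _ y /allpairsP[[v c] /= [vb csc ->]]; rewrite inE => /predU1P[->|ys].
  by exists c; rewrite -adE (scP v).2.
have [a yv] := eb v y vb ys; exists a.
rewrite -adE spectral_proj_comm ?adE ?yv ?linearZ // => z.
have yh : y \in h by apply: sh; rewrite inE ys orbT.
apply/eqP; rewrite -subr_eq0 !adE -jacobi_ad (abh y x yh xh).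
by rewrite bracket0l.
Qed.

Lemma weight_basis : exists2 b : seq g, basis_of fullv b &
  forall v, v \in b -> exists lambda, root_space lambda v.
Proof.
have [|s ss es] := @joint_eigenspanning (vbasis h).
  by move=> x; exact: vbasis_mem.
have [b bb sb] := basis_of_spanning ss; exists b => // v vb.
have v0 : v != 0 by exact: free_not0 (basis_free bb) vb.
have vfree : free [tuple v] by rewrite seq1_free.
have coordv c : coord [tuple v] ord0 (c *: v) = c.
  by rewrite linearZ /= (coord_free ord0 ord0 vfree) mulr1.
have lin : linear (fun H => coord [tuple v] ord0 (bracket (vsval H) v) : K^o).
  by move=> c H1 H2; rewrite linearP /= bracket_linearl linearP.
(* The weight of [v] is read off as the coordinate of [[H, v]] along [v], which makes it linear in
   [H] by construction. *)
exists (linfun (fun H => coord [tuple v] ord0 (bracket (vsval H) v) : K^o)) => H.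
rewrite (linfunE_of lin).
suff [c ->] : exists c, bracket (vsval H) v = c *: v by rewrite coordv.
rewrite (coord_vbasis (subvsP H)).
have lin2 : linear (fun x => bracket x v) by exact: bracket_linearl.
rewrite -(linfunE_of lin2) linear_sum /=.
exists (\sum_(i < \dim h) coord (vbasis h) i (vsval H) *
          coord [tuple v] ord0 (bracket (vbasis h)`_i v)).
rewrite scaler_suml; apply: eq_bigr => i _.
rewrite linearZ /= (linfunE_of lin2) -scalerA; congr (_ *: _).
have [||c ->] := es v (vbasis h)`_i; rewrite ?coordv //; first exact: sb.
by rewrite mem_nth // size_tuple.
Qed.

Lemma root_space_bracket alpha beta x y :
  root_space alpha x -> root_space beta y -> root_space (alpha + beta) (bracket x y).
Proof.
move=> ax by_ H; rewrite add_lfunE scalerDl.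
have := jacobi_ad (vsval H) x y; rewrite ax by_ bracketZl bracketZr.
by move/eqP; rewrite eq_sym subr_eq => /eqP.
Qed.

(** The Cartan subalgebra is its own centralizer: if [x] commutes with [h], then [h + <[x]>] is
    abelian, hence equal to [h] by maximality. *)
Lemma root_space0P x : reflect (root_space (0 : dual) x) (x \in h).
Proof.
have [abh maxh _] := h_cartan; apply: (iffP idP) => [xh H|x0].
  by rewrite abh ?subvsP // lfunE /= scale0r.
have hx y : y \in h -> bracket y x = 0.
  by move=> yh; rewrite -(vsprojK yh) x0 lfunE /= scale0r.
suff ab : abelian_sub (h + <[x]>)%VS.
  by rewrite -(maxh _ ab) ?addvSl // memvE addvSr.
move=> u w /memv_addP[y1 y1h [_ /vlineP[c1 ->] ->]].
move=> /memv_addP[y2 y2h [_ /vlineP[c2 ->] ->]].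
rewrite bracketDl !bracketDr !bracketZl !bracketZr bracketxx abh // (hx y1) //.
by rewrite (bracketC x) hx // !(oppr0, scaler0, addr0).
Qed.

(** Invariance gives [(alpha + beta) H * killing x y = 0] for every [H]. *)
Lemma root_space_orthogonal alpha beta x y :
    root_space alpha x -> root_space beta y -> alpha + beta <> 0 ->
  killing x y = 0.
Proof.
move=> ax by_ ab; apply/eqP/negPn/negP => k0; apply: ab.
apply/lfunP => H; rewrite add_lfunE lfunE /=; apply: (mulIf k0).
rewrite mul0r mulrDl -killingZl -ax bracketC killingNl killing_invariant by_.
by rewrite killingC killingZl killingC addNr.
Qed.

(** * Nondegeneracy, and Cartan elements representing weights *)

Hypothesis killing_nd : forall x, (forall y, killing x y = 0) -> x = 0.

Lemma killing_eq0 (b : seq g) x : <<b>>%VS = fullv ->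
  (forall v, v \in b -> killing x v = 0) -> x = 0.
Proof.
move=> bb kx; apply: killing_nd => y; rewrite -killing_formE.
rewrite (eq_lfun_spanning (f := killing_form x) (e := 0) bb) ?lfunE // => v vb.
by rewrite killing_formE kx // lfunE.
Qed.

(** In a basis of weight vectors, only those of weight [- lambda] can pair nontrivially with [x];
    nondegeneracy provides one. *)
Lemma dual_root_vector lambda x : root_space lambda x -> x <> 0 ->
  exists2 y, root_space (- lambda) y & killing x y <> 0.
Proof.
move=> lx x0; apply: contrapT => noy; apply: x0.
have [b /span_basis bb bw] := weight_basis; apply: (killing_eq0 bb) => v vb.
apply: contrapT => kv; apply: noy; exists v => //.
have [nu nv] := bw v vb; suff -> : - lambda = nu by [].
apply/eqP; rewrite -subr_eq0 -oppr_eq0 opprB opprK addrC; apply/eqP.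
by apply: contrapT => /(root_space_orthogonal lx nv).
Qed.

(** This is nondegeneracy of the form restricted to [h]: vectors of nonzero weight are orthogonal to
    [h], and those of weight zero lie in [h]. *)
Lemma killing_eq0_cartan x : x \in h ->
  (forall H, killing x (vsval H) = 0) -> x = 0.
Proof.
move=> xh kx; have [b /span_basis bb bw] := weight_basis.
apply: (killing_eq0 bb) => v vb; have [nu nv] := bw v vb.
have [nu0|nu0] := pselect (nu = 0).
  by rewrite nu0 in nv; move/root_space0P: nv => /vsprojK <-.
by apply: (root_space_orthogonal (root_space0P _ xh) nv); rewrite add0r.
Qed.

Lemma killing_bracket alpha e f H : root_space (- alpha) f ->
  killing (bracket e f) (vsval H) = alpha H * killing e f.
Proof.
move=> af; rewrite killing_invariant bracketC af opp_lfunE scaleNr opprK.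
by rewrite killingC killingZl killingC.
Qed.

(** Unlike for [is_root], zero is allowed, since root strings may pass through it. *)
Definition weight lambda := exists2 x, root_space lambda x & x <> 0.

(** For paired vectors [e] and [f] of weights [lambda] and [- lambda], the element [[e, f] / killing
    e f] of [h] represents [lambda]. So the choice in [killing_vec] is made from a nonempty set. *)
Lemma killing_vecE lambda H : weight lambda ->
  killing (vsval (killing_vec lambda)) (vsval H) = lambda H.
Proof.
move=> [e le e0].
suff : exists t : subvs_of h, forall H,
    killing (vsval t) (vsval H) = lambda H by move/(xgetPex 0); apply.
have [f lf /eqP kef] := dual_root_vector le e0.
have efh : bracket e f \in h.
  by apply/root_space0P; rewrite -(subrr lambda); exact: root_space_bracket.
exists (vsproj h ((killing e f)^-1 *: bracket e f)) => H'.
rewrite vsprojK ?memvZ // killingZl (killing_bracket _ _ lf) mulrC.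
by rewrite mulfK.
Qed.

Lemma killing_vec_unique lambda (t : subvs_of h) : weight lambda ->
  (forall H, killing (vsval t) (vsval H) = lambda H) -> t = killing_vec lambda.
Proof.
move=> wl tl; apply/val_inj/eqP; rewrite -subr_eq0; apply/eqP.
apply: killing_eq0_cartan => [|H]; first by rewrite memvB ?subvsP.
by rewrite killingBl tl killing_vecE // subrr.
Qed.

Lemma bracket_root alpha e f : root_space alpha e -> root_space (- alpha) f ->
  e <> 0 -> bracket e f = killing e f *: vsval (killing_vec alpha).
Proof.
move=> ae af e0; have efh : bracket e f \in h.
  by apply/root_space0P; rewrite -(subrr alpha); exact: root_space_bracket.
apply/eqP; rewrite -subr_eq0; apply/eqP.
apply: killing_eq0_cartan => [|H]; first by rewrite memvB ?memvZ ?subvsP.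
have wa : weight alpha by exists e.
rewrite killingBl killingZl (killing_bracket _ _ af) killing_vecE //.
by rewrite mulrC subrr.
Qed.

(** * Root strings and integrality *)

Lemma root_space_iter alpha beta e v m :
    root_space alpha e -> root_space beta v ->
  root_space (beta + alpha *+ m) (iter m (bracket e) v).
Proof.
move=> ae bv; elim: m => [|m IH]; first by rewrite mulr0n addr0.
by rewrite iterS mulrS addrCA; exact: root_space_bracket.
Qed.

(** Fix [H] with [alpha H] nonzero. Nonzero iterates are eigenvectors of [ad H] for the pairwise
    distinct values [(beta + alpha *+ m) H], and [ad H] has finitely many eigenvalues. *)
Lemma root_vector_nilpotent alpha beta e v : alpha <> 0 ->
    root_space alpha e -> root_space beta v -> v <> 0 ->
  exists2 m, iter m (bracket e) v <> 0 & iter m.+1 (bracket e) v = 0.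
Proof.
move=> alpha0 ae bv v0.
have [H aH] : exists H, alpha H != 0.
  apply: contrapT => noH; apply: alpha0; apply/lfunP => H; rewrite lfunE /=.
  by apply/eqP/negPn/negP => aH; apply: noH; exists H.
have [_ _ /(_ _ (subvsP H)) [b bb bH]] := h_cartan.
have [s sP] := eigenvalues_finite bb bH.
have : exists m, iter m (bracket e) v == 0.
  apply: contrapT => niter.
  have /(uniq_leq_size _) : {subset [seq (beta + alpha *+ m) H |
      m <- iota 0 (size s).+1] <= s}.
    move=> _ /mapP[m _ ->]; apply: (sP (iter m (bracket e) v)).
      by apply/eqP/negP => im0; apply: niter; exists m.
    by rewrite adE; exact: root_space_iter.
  rewrite size_map size_iota ltnn => uniqF; suff: false by [].
  apply: uniqF; rewrite map_inj_uniq ?iota_uniq // => m n.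
  rewrite -!scaler_nat !add_lfunE !scale_lfunE => /addrI/(mulIf aH)/eqP.
  by rewrite eqr_nat => /eqP.
(* The least vanishing exponent is positive because [v] is nonzero; its predecessor is the
   witness. *)
move/find_ex_minn => [[|m] /eqP im0 minm]; first by [].
by exists m => // /eqP /minm; rewrite ltnn.
Qed.

(** The usual sl2 computation: moving [f] past each [e] produces [- [e, f]], which acts on weight
    [beta + j alpha] by a scalar. The coefficient is the sum of these scalars for [j] from 0 to
    [k]. *)
Lemma bracket_raise alpha beta e f v k :
    root_space alpha e -> root_space (- alpha) f -> e <> 0 ->
    root_space beta v -> bracket f v = 0 ->
  bracket f (iter k.+1 (bracket e) v)
    = (- killing e f * k.+1%:R * (beta (killing_vec alpha)
        + k%:R / 2 * alpha (killing_vec alpha))) *: iter k (bracket e) v.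
Proof.
move=> ae af e0 bv fv.
have step k' : bracket f (iter k'.+1 (bracket e) v)
    = bracket e (bracket f (iter k' (bracket e) v)) -
      (killing e f * (beta (killing_vec alpha) + k'%:R * alpha (killing_vec alpha)))
        *: iter k' (bracket e) v.
  have := jacobi_ad e f (iter k' (bracket e) v).
  rewrite (bracket_root ae af e0) bracketZl (root_space_iter k' ae bv).
  rewrite -scaler_nat add_lfunE scale_lfunE scalerA => ->.
  by rewrite opprB addrCA subrr addr0 iterS.
elim: k => [|k IH].
  rewrite step /= fv -adE linear0 sub0r -scaleNr; congr (_ *: _); ring.
rewrite step IH bracketZr -iterS -scalerBl; congr (_ *: _).
by rewrite -!(natr1 k.+1) -(natr1 k); field.
Qed.

(** Here [m] counts the steps from [v] down to the last nonzero vector, and [k] the steps from there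
    up to the top of the string. *)
Lemma root_string alpha beta : is_root alpha -> weight beta ->
  exists m k : nat, 2 * beta (killing_vec alpha)
    = (2 * m%:R - k%:R) * alpha (killing_vec alpha) /\
    ((0 < m)%N -> weight (beta - alpha)).
Proof.
move=> [alpha0 [e ae e0]] [v bv v0].
have [f af kef] := dual_root_vector ae e0.
have [|m v'0 fv'] := root_vector_nilpotent _ af bv v0.
  by move/eqP; rewrite oppr_eq0 => /eqP.
have bv' := root_space_iter m af bv.
have [k v''0 ev''] := root_vector_nilpotent alpha0 ae bv' v'0.
exists m, k; split; last first.
  move=> m0; exists (bracket f v); first by rewrite addrC; exact: root_space_bracket.
  move=> fv; apply: v'0; rewrite -(prednK m0) iterSr fv.
  by elim: (m.-1) => //= j ->; rewrite -adE linear0.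
(* One step above the top the vector is zero while the top vector is not, so the scalar of
   [bracket_raise] vanishes, at the bottom weight [beta - m alpha]. *)
have := bracket_raise k ae af e0 bv' fv'.
rewrite ev'' -adE linear0 => /esym/eqP.
rewrite scaler_eq0; move/eqP/negPf: v''0 => ->; rewrite orbF !mulf_eq0 oppr_eq0.
move/eqP/negPf: kef => ->; rewrite pnatr_eq0 /= -scaler_nat scalerN.
rewrite add_lfunE opp_lfunE scale_lfunE -[_ *: _]/(_ * _).
set A := alpha _; set B := beta _ => /eqP E.
transitivity (2 * (B + - (m%:R * A) + k%:R / 2 * A) + (2 * m%:R - k%:R) * A).
  by field.
by rewrite E mulr0 add0r.
Qed.

Lemma pairing_int alpha beta : is_root alpha -> weight beta ->
  exists z : int, 2 * beta (killing_vec alpha) = z%:~R * alpha (killing_vec alpha)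
    /\ (0 < z -> weight (beta - alpha)).
Proof.
move=> ra wb; have [m [k [E mP]]] := root_string ra wb.
exists (2 * m%:Z - k%:Z); split=> [|z0]; last by apply: mP; lia.
by rewrite E rmorphB rmorphM /= !pmulrn.
Qed.

Lemma pairing_sym alpha beta : weight alpha -> weight beta ->
  alpha (killing_vec beta) = beta (killing_vec alpha).
Proof. by move=> wa wb; rewrite -!killing_vecE // killingC. Qed.

(** * Positivity of the form *)

(** In a weight basis [ad H] is diagonal, so the trace of its square is the sum of squared weights,
    listed in [s] with multiplicity. If all of them vanish at [H], then [ad H = 0]. *)
Lemma killing_sum_sqr : exists s : seq dual,
  (forall lambda, lambda \in s -> weight lambda) /\
  forall H, killing (vsval H) (vsval H) = \sum_(lambda <- s) lambda H ^+ 2 /\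
    ((forall lambda, lambda \in s -> lambda H = 0) -> H = 0).
Proof.
have [b bb bw] := weight_basis; pose X := in_tuple b.
have memX (i : 'I_(size b)) : X`_i \in b by rewrite mem_nth.
have [lam lamP] := fin_all_exists (fun i : 'I_(size b) => bw _ (memX i)).
exists [seq lam i | i <- enum 'I_(size b)]; split.
  move=> _ /mapP[i _ ->]; exists X`_i => //; apply/eqP.
  exact: free_not0 (basis_free bb) (memX i).
move=> H; split.
  rewrite big_map big_enum /=.
  rewrite /killing (@lfun_traceE _ _ _ X) //.
  apply: eq_bigr => i _; rewrite comp_lfunE !adE lamP bracketZr lamP scalerA.
  by rewrite linearZ /= (coord_free (X := X) i i (basis_free bb)) eqxx mulr1 expr2.
move=> lam0; apply: val_inj; apply: killing_nd => y; rewrite /killing.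
have -> : ad (\val H) = 0; last by rewrite comp_lfun0l lfun_trace0.
apply: (eq_lfun_spanning (span_basis bb)) => v /(nthP 0)[j jb <-].
have := lamP (Ordinal jb) H; rewrite /= adE => ->.
by rewrite lam0 ?scale0r ?lfunE //; apply: map_f; rewrite mem_enum.
Qed.

(** Write [a] for the norm. If [a = 0], integrality makes every weight vanish at
    [killing_vec alpha], forcing [alpha = 0]. Otherwise the sum-of-squares formula, rescaled, reads
    [S * a = 4] with [S] a sum of squared integers; this gives reality and positivity of [a] at
    once. *)
Lemma root_norm_gt0 alpha : is_root alpha -> 0 < alpha (killing_vec alpha).
Proof.
move=> ra; have wa : weight alpha by case: ra.
have [s [sw sP]] := killing_sum_sqr.
have [sqE t0] := sP (killing_vec alpha); rewrite killing_vecE // in sqE.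
set a := alpha _ in sqE *.
have a0 : a != 0.
  apply/eqP => a0; have [+ _] := ra; apply; apply/lfunP => H; rewrite lfunE /=.
  rewrite -killing_vecE // t0 ?linear0 => [|lambda /sw wl].
    by rewrite killingC -killing_formE linear0.
  have [z [+ _]] := pairing_int ra wl; rewrite -/a a0 mulr0 => /eqP.
  by rewrite mulf_eq0 pnatr_eq0 => /eqP.
pose S := \sum_(lambda <- s) (2 * lambda (killing_vec alpha) / a) ^+ 2.
have Sa : S * a = 4.
  have -> : S = 4 * a / a ^+ 2.
    rewrite [in 4 * a]sqE mulr_sumr mulr_suml; apply: eq_bigr => lambda _.
    by field.
  by field.
have S0 : 0 <= S.
  rewrite /S big_seq; apply: sumr_ge0 => lambda /sw wl.
  have [z [-> _]] := pairing_int ra wl; rewrite mulfK // -rmorphXn /= ler0z.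
  exact: sqr_ge0.
have Sgt0 : 0 < S.
  rewrite lt_def S0 andbT; apply/eqP => S00.
  by move/eqP: Sa; rewrite S00 mul0r eq_sym pnatr_eq0.
by rewrite -(pmulr_rgt0 _ Sgt0) Sa ltr0n.
Qed.

Lemma pairing_real alpha beta : is_root alpha -> weight beta ->
  beta (killing_vec alpha) \is Num.real.
Proof.
move=> ra wb; have [z [E _]] := pairing_int ra wb.
have -> : beta (killing_vec alpha) = z%:~R * alpha (killing_vec alpha) / 2.
  by rewrite -E mulrC mulKf // pnatr_eq0.
by rewrite !realM ?realV ?realz ?gtr0_real ?root_norm_gt0 ?ltr0n.
Qed.

(** The form is a sum of squares of weights; reality makes each square nonnegative, so all of them
    vanish. *)
Lemma killing_pos_def H :
    (forall lambda, weight lambda -> lambda H \is Num.real) ->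
  killing (vsval H) (vsval H) <= 0 -> H = 0.
Proof.
move=> Hreal; have [s [sw sP]] := killing_sum_sqr.
have [-> H0] := sP H; move=> le0; apply: H0 => lambda ls.
have ge0 nu : nu \in s -> 0 <= nu H ^+ 2.
  by move=> /sw /Hreal nuH; apply: real_exprn_even_ge0.
have : lambda H ^+ 2 <= 0.
  apply: le_trans le0; rewrite (big_rem lambda) //= lerDl big_seq.
  by apply: sumr_ge0 => nu /mem_rem; exact: ge0.
move=> le0'; apply/eqP; rewrite -sqrf_eq0 eq_le le0' ge0 //.
Qed.

(** * Bounds on pairings, and sums and differences of roots *)

(** If [z] were at least 2, the squared length of [beta - alpha], namely
    [|beta|^2 + |alpha|^2 - z |alpha|^2], would be at most 0, and positivity would give
    [beta = alpha]. *)
Lemma pairing_le1 alpha beta (z : int) : is_root alpha -> is_root beta ->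
    beta (killing_vec beta) <= alpha (killing_vec alpha) -> beta <> alpha ->
    2 * beta (killing_vec alpha) = z%:~R * alpha (killing_vec alpha) ->
  z <= 1.
Proof.
move=> ra rb le_ba neq_ba E.
have [wa wb] : weight alpha /\ weight beta by case: ra => _ ?; case: rb.
rewrite leNgt; apply/negP => z2; apply: neq_ba.
suff t0 : killing_vec beta - killing_vec alpha = 0.
  apply/lfunP => H; rewrite -!killing_vecE //.
  by move/eqP: t0; rewrite subr_eq0 => /eqP ->.
apply: killing_pos_def => [lambda wl|].
  by rewrite linearB realB ?pairing_real.
rewrite linearB /= killingBl ![killing _ (_ - _)]killingC !killingBl.
rewrite !killing_vecE // (pairing_sym wa wb).
have -> : beta (killing_vec beta) - beta (killing_vec alpha)
    - (beta (killing_vec alpha) - alpha (killing_vec alpha))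
  = beta (killing_vec beta) + alpha (killing_vec alpha)
    - 2 * beta (killing_vec alpha) by ring.
rewrite E subr_le0 (le_trans (lerD le_ba (lexx _))) // -mulr2n -mulr_natl.
by rewrite ler_wpM2r ?(ltW (root_norm_gt0 ra)) // pmulrn ler_int; lia.
Qed.

(** A positive pairing means that the [alpha]-string through [beta] continues downwards. *)
Lemma root_sub alpha beta : is_root alpha -> is_root beta -> beta <> alpha ->
  0 < beta (killing_vec alpha) -> is_root (beta - alpha).
Proof.
move=> ra rb neq_ba gt0; split; first by move/eqP; rewrite subr_eq0 => /eqP.
have [|z [E zP]] := @pairing_int alpha beta ra; first by case: rb.
apply: zP; rewrite -(ltr0z K) -(pmulr_lgt0 _ (root_norm_gt0 ra)) -E.
by rewrite pmulr_rgt0 ?ltr0n.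
Qed.

Lemma is_rootN alpha : is_root alpha -> is_root (- alpha).
Proof.
move=> [alpha0 [e ae e0]]; split.
  by move/eqP; rewrite oppr_eq0 => /eqP.
have [f af kef] := dual_root_vector ae e0; exists f => // f0.
by apply: kef; rewrite f0 -killing_formE linear0.
Qed.

Lemma root_add alpha beta : is_root alpha -> is_root beta -> alpha + beta <> 0 ->
  beta (killing_vec alpha) < 0 -> is_root (alpha + beta).
Proof.
move=> ra rb ab0 lt0; have rNa := is_rootN ra.
have wa : weight alpha by case: ra.
have tN : - killing_vec alpha = killing_vec (- alpha).
  apply: killing_vec_unique => [|H]; first by case: rNa.
  by rewrite linearN killingNl killing_vecE // opp_lfunE.
rewrite addrC -[alpha]opprK; apply: root_sub => //.
  by move=> E; apply: ab0; rewrite E subrr.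
by rewrite -tN linearN oppr_gt0.
Qed.

Lemma dual_form_root alpha : is_root alpha ->
  dual_form alpha alpha = alpha (killing_vec alpha).
Proof. by move=> [_ wa]; rewrite /dual_form killing_vecE. Qed.

(** * Two decompositions of a sum of long roots *)

(** Pairing the two decompositions with [mu] gives [2 + ze = zr + zs]. Both [zr] and [zs] are at
    most 1 since [mu] is long, and [ze] is nonnegative since otherwise [mu + epsilon] would be a
    root; hence equality throughout. *)
Lemma long_pairing mu epsilon rho sigma :
    is_root mu -> is_root epsilon -> is_root rho -> is_root sigma ->
    mu + epsilon = rho + sigma -> long mu ->
    ~ is_root (mu + epsilon) -> mu + epsilon <> 0 -> rho <> mu -> sigma <> mu ->
  2 * rho (killing_vec mu) = mu (killing_vec mu).
Proof.
move=> rm re rr rs E lm nr n0 rhomu sigmamu.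
have N0 := root_norm_gt0 rm.
have w lambda : is_root lambda -> weight lambda by case.
have le_mu lambda : is_root lambda ->
    lambda (killing_vec lambda) <= mu (killing_vec mu).
  by move=> rl; rewrite -!dual_form_root //; exact: lm.
have [zr [Er _]] := pairing_int rm (w _ rr).
have [zs [Es _]] := pairing_int rm (w _ rs).
have [ze [Ee _]] := pairing_int rm (w _ re).
have zr1 := pairing_le1 rm rr (le_mu _ rr) rhomu Er.
have zs1 := pairing_le1 rm rs (le_mu _ rs) sigmamu Es.
have ze0 : 0 <= ze.
  rewrite leNgt; apply/negP => ze0; apply: nr; apply: root_add => //.
  rewrite -(pmulr_rlt0 (x := 2)) ?ltr0n // Ee.
  by rewrite pmulr_llt0 // ltrz0.
have : 2 + ze = zr + zs.
  apply/eqP; rewrite -(eqr_int K) [(2 + ze)%:~R]intrD [(zr + zs)%:~R]intrD.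
  rewrite -[2%:~R]/(2 : K) -(inj_eq (mulIf (lt0r_neq0 N0))).
  rewrite [(2 + _) * _]mulrDl [(zr%:~R + _) * _]mulrDl -Er -Es -Ee -!mulrDr.
  have /lfunP/(_ (killing_vec mu)) := E; rewrite !add_lfunE => Et.
  by rewrite [X in 2 * X == _]Et.
move=> sumz; have zr_1 : zr = 1 by lia.
by rewrite Er zr_1 mul1r.
Qed.

(** All four pairings of [rho], [sigma] with [mu], [epsilon] are half the long length [N]. So
    [mu + epsilon] pairs to [N] with each summand, and the summands have equal length. Integrality
    then excludes that [rho] is shorter than [mu]. *)
Lemma long_summand mu epsilon rho sigma :
    is_root mu -> is_root epsilon -> is_root rho -> is_root sigma ->
    mu + epsilon = rho + sigma -> long mu -> long epsilon ->
    ~ is_root (mu + epsilon) -> mu + epsilon <> 0 ->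
    rho <> mu -> sigma <> mu -> rho <> epsilon -> sigma <> epsilon ->
    rho <> sigma ->
  rho (killing_vec rho) = mu (killing_vec mu) /\
  (mu + epsilon) (killing_vec rho) = mu (killing_vec mu).
Proof.
move=> rm re rr rs E lm le nr n0 rhomu sigmamu rhoeps sigmaeps rhosigma.
have w lambda : is_root lambda -> weight lambda by case.
have eqN : epsilon (killing_vec epsilon) = mu (killing_vec mu).
  by apply/le_anti; rewrite -!dual_form_root // lm // le.
have L0 := root_norm_gt0 rr; have N0 := root_norm_gt0 rm.
have E' : epsilon + mu = rho + sigma by rewrite addrC.
have Es : mu + epsilon = sigma + rho by rewrite E addrC.
have Es' : epsilon + mu = sigma + rho by rewrite addrC.
have nr' : ~ is_root (epsilon + mu) by rewrite addrC.
have n0' : epsilon + mu <> 0 by rewrite addrC.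
have rm2 := long_pairing rm re rr rs E lm nr n0 rhomu sigmamu.
have re2 := long_pairing re rm rr rs E' le nr' n0' rhoeps sigmaeps.
have sm2 := long_pairing rm re rs rr Es lm nr n0 sigmamu rhomu.
have se2 := long_pairing re rm rs rr Es' le nr' n0' sigmaeps rhoeps.
have two0 : (2 : K) != 0 by rewrite pnatr_eq0.
have sumE lambda : weight lambda -> 2 * lambda (killing_vec mu) = mu (killing_vec mu) ->
    2 * lambda (killing_vec epsilon) = epsilon (killing_vec epsilon) ->
    (mu + epsilon) (killing_vec lambda) = mu (killing_vec mu).
  move=> wl l1 l2; rewrite add_lfunE (pairing_sym (w _ rm) wl).
  rewrite (pairing_sym (w _ re) wl); apply: (mulfI two0).
  by rewrite mulrDr l1 l2 eqN -mulr2n mulr_natl.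
have sumr := sumE _ (w _ rr) rm2 re2; have sums := sumE _ (w _ rs) sm2 se2.
split=> //.
have eqL : rho (killing_vec rho) + sigma (killing_vec rho) = mu (killing_vec mu).
  by rewrite -sumr E add_lfunE.
have eqM : sigma (killing_vec sigma) + sigma (killing_vec rho) = mu (killing_vec mu).
  by rewrite -sums Es add_lfunE (pairing_sym (w _ rr) (w _ rs)).
have eqLM : sigma (killing_vec sigma) = rho (killing_vec rho).
  by apply: (addIr (sigma (killing_vec rho))); rewrite eqL eqM.
have [p [Ep _]] := pairing_int rr (w _ rs).
have [q [Eq _]] := pairing_int rr (w _ rm).
have p1 : p <= 1.
  by apply: (pairing_le1 rr rs _ _ Ep); [rewrite eqLM|move/esym].
have Nq : mu (killing_vec mu) = q%:~R * rho (killing_vec rho).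
  by rewrite -Eq (pairing_sym (w _ rm) (w _ rr)).
(* Twice the identity [|rho|^2 + (sigma, rho) = N], divided by [|rho|^2], where [q = N / |rho|^2].
   With [p] at most 1 this leaves [q] at most 1, while [mu] being long gives [q] at least 1. *)
have pq : 2 + p = 2 * q.
  apply/eqP; rewrite -(eqr_int K) rmorphD rmorphM /=.
  rewrite -(inj_eq (mulIf (lt0r_neq0 L0))) mulrDl -Ep -mulrA -Nq -mulrDr eqL.
  exact: eqxx.
have q1 : 1 <= q.
  rewrite -(ler_int K) -(ler_pM2r L0) mul1r -Nq -!dual_form_root //.
  exact: lm.
have q_1 : q = 1 by lia.
by rewrite Nq q_1 mul1r.
Qed.

(** * Roots occurring in a sum of root spaces *)

(** Take [y] of weight [- lambda] pairing nontrivially with [x]. If [lambda] were not among the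
    roots in [A], every generating root space would be orthogonal to [y], hence so would the whole
    sum, including [x]. *)
Lemma mem_sum_root_spaces lambda x (A : set dual) :
    root_space lambda x -> x <> 0 -> x \in sum_root_spaces A ->
  A lambda /\ is_root lambda.
Proof.
move=> lx x0 xA; have [y ly kxy] := dual_root_vector lx x0.
apply: contrapT => nA; apply: kxy.
have [_ minA] := lspanP (\bigcup_(alpha in A `&` @is_root _ _ h) root_space alpha).
have /subvP/(_ x xA) : (sum_root_spaces A <= lker (killing_form y))%VS.
  apply: minA => v [beta [Ab rb] bv] /=; rewrite memv_ker killing_formE.
  apply/eqP; apply: (root_space_orthogonal ly bv) => E; apply: nA.
  by suff -> : lambda = beta by []; move/eqP: E; rewrite addrC subr_eq0 => /eqP.
by rewrite memv_ker killing_formE killingC => /eqP.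
Qed.

Lemma roots_in_sum_root_spaces lambda (A : set dual) :
  roots_in (sum_root_spaces A) lambda -> A lambda.
Proof. by move=> [[_ [x lx x0]] sub]; have [] := mem_sum_root_spaces lx x0 (sub _ lx). Qed.

End CartanDecomposition.

(** * Degrees in the parabolic grading, and pairings with [gamma_j] *)

Theorem lemma6p33 (R : realType) (g : lieAlgebra R[i]) (h : {vspace g})
    (T : dynkin_type) (Pi : (lie_rank T).-tuple 'Hom(subvs_of h, R[i]^o))
    (i : 'I_(lie_rank T)) (mu gamma : 'Hom(subvs_of h, R[i]^o)) :
  simple_lie g -> cartan_subalgebra h -> simple_roots Pi -> has_type T Pi ->
  quasi_heisenberg Pi i -> listed_type T i.+1 ->
  highest_weight Pi i (@ad _ g) (grade1 Pi i) mu ->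
  highest_weight Pi i (@ad _ g) (center_nil Pi i) gamma ->
  forall epsilon : 'Hom(subvs_of h, R[i]^o),
  special Pi i mu gamma (mu + epsilon) -> type_1a mu epsilon ->
  forall alpha gamma_j : 'Hom(subvs_of h, R[i]^o),
  roots_in_for (mu + epsilon) (grade1 Pi i) alpha ->
  roots_in_for (mu + epsilon) (center_nil Pi i) gamma_j ->
  is_root (gamma_j - alpha).
Proof.
move=> simple_g cartan_h _ typePi _ _ [v [v1 v0 muv _]] _ epsilon.
(* The root supplied by [special] is identified with [epsilon] by cancelling [mu]. *)
move=> [_ _ [epsilon' + /addrI eps_eq]]; rewrite -{epsilon'}eps_eq => eps1.
move=> [nroot _ long_mu long_eps] alpha gamma_j [alpha1 ralpha'] [gamma2 rbeta].
have nd : forall x : g, (forall y, killing x y = 0) -> x = 0.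
  apply: killing_nondegenerate => //.
  (* If [killing t t] were 0, the diagonal Cartan integer would be 0, as division by zero yields 0,
     whereas [has_type] makes it 2. *)
  pose t := vsval (killing_vec (tnth Pi i)); exists t, t => kt0.
  have := typePi i i; rewrite /cartan_integer /dual_form kt0 mulr0 mul0r.
  by rewrite /bourbaki_cartan eqxx => /eqP; rewrite eq_sym intr_eq0.
have muv' : root_space mu v by move=> H; rewrite -adE.
have [cmu rmu] := mem_sum_root_spaces cartan_h nd muv' v0 v1.
have ceps := roots_in_sum_root_spaces cartan_h nd eps1.
have calpha := roots_in_sum_root_spaces cartan_h nd alpha1.
have cgamma := roots_in_sum_root_spaces cartan_h nd gamma2.
have [[reps _] [ralpha _] [rgamma _]] := And3 eps1 alpha1 gamma2.
rewrite /= in cmu ceps calpha cgamma.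
have cnu : coord Pi i (mu + epsilon) = 2 by rewrite linearD /= cmu ceps.
have neq_coord beta beta' : coord Pi i beta != coord Pi i beta' -> beta <> beta'.
  by move/eqP=> neq eqb; apply: neq; rewrite eqb.
have calpha' : coord Pi i (mu + epsilon - alpha) = 1.
  by rewrite linearB /= cnu calpha; ring.
have cbeta : coord Pi i (mu + epsilon - gamma_j) = 0.
  by rewrite linearB /= cnu cgamma subrr.
have [L nu_gamma] : gamma_j (killing_vec gamma_j) = mu (killing_vec mu) /\
    (mu + epsilon) (killing_vec gamma_j) = mu (killing_vec mu).
  (* Applied with [rho = gamma_j] of degree 2 and [sigma = mu + epsilon - gamma_j] of degree 0.
     Since [mu] and [epsilon] have degree 1 and their sum degree 2, comparing degrees settles every
     required inequality. *)
  apply: (long_summand cartan_h nd rmu reps rgamma rbeta) => //;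
    rewrite ?(addrC gamma_j) ?subrK //; apply: neq_coord;
    rewrite ?cnu ?cgamma ?cmu ?ceps ?cbeta ?linear0;
    by rewrite ?(eqr_nat _ 2 1) ?(eqr_nat _ 0 1) ?pnatr_eq0.
have gt0 := root_norm_gt0 cartan_h nd rgamma.
have wt (beta : 'Hom(subvs_of h, R[i]^o)) : is_root beta -> weight beta by case.
have le_norm (beta : 'Hom(subvs_of h, R[i]^o)) : is_root beta ->
    beta (killing_vec beta) <= gamma_j (killing_vec gamma_j).
  by move=> rb; have := long_mu _ rb; rewrite !(dual_form_root cartan_h nd) // L.
have [z1 [E1 _]] := pairing_int cartan_h nd rgamma (wt _ ralpha).
have [z2 [E2 _]] := pairing_int cartan_h nd rgamma (wt _ ralpha').
have neq1 : alpha <> gamma_j.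
  by apply: neq_coord; rewrite calpha cgamma (eqr_nat _ 1 2).
have neq2 : mu + epsilon - alpha <> gamma_j.
  by apply: neq_coord; rewrite calpha' cgamma (eqr_nat _ 1 2).
have z1_le := pairing_le1 cartan_h nd rgamma ralpha (le_norm _ ralpha) neq1 E1.
have z2_le := pairing_le1 cartan_h nd rgamma ralpha' (le_norm _ ralpha') neq2 E2.
(* Pairing [alpha + (mu + epsilon - alpha)] with the long root [gamma_j] gives the full length of
   [gamma_j]. As neither summand exceeds half of it, each contributes exactly half. *)
have sumz : z1 + z2 = 2.
  have : (alpha + (mu + epsilon - alpha)) (killing_vec gamma_j)
      = gamma_j (killing_vec gamma_j) by rewrite addrC subrK nu_gamma L.
  rewrite add_lfunE => sumt.
  apply/eqP; rewrite -(eqr_int R[i]) intrD -(inj_eq (mulIf (lt0r_neq0 gt0))).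
  by rewrite mulrDl -E1 -E2 -mulrDr sumt.
have z1_1 : z1 = 1 by lia.
apply: (root_sub cartan_h nd) => //; first by move/esym.
rewrite (pairing_sym cartan_h nd (wt _ rgamma) (wt _ ralpha)).
by rewrite -(pmulr_rgt0 (x := 2)) ?ltr0n // E1 z1_1 mul1r.
Qed.
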